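(* Let an instance $(T, I, Q, p, \overline{\delta})$ of the futures opening auction problem be given (as defined in the context), and assume that the clearing constraint matrix $(Q_{i,t})_{t\in T,\, i\in I}$ has rank $|T|\ge 1$. Let $G$ be a real number with $G>2|T|$ and consider the min cost flow linear program $$\max\ \sum_{i\in I}\Bigl(1+G\sum_{t\in T}p_{i,t}Q_{i,t}\Bigr)\delta_i\quad\text{s.t.}\quad \sum_{i\in I}Q_{i,t}\,\delta_i=0\ \ \forall t\in T,\qquad 0\le\delta_i\le\overline{\delta}_i\ \ \forall i\in I,\qquad \delta\in\mathbb{R}^I, \tag{P}$$ whose linear programming dual is $$\min\ \sum_{i\in I}\overline{\delta}_i\,\overline{v}_i\quad\text{s.t.}\quad \sum_{t\in T}Q_{i,t}\pi_t+\overline{v}_i-\underline{v}_i=1+G\sum_{t\in T}p_{i,t}Q_{i,t},\ \ \overline{v}_i\ge0,\ \underline{v}_i\ge0\ \ \forall i\in I,\qquad \pi\in\mathbb{R}^T. \tag{D}$$ Let $\delta^*$ be an optimal extreme point of (P), let $(\pi^*,\overline{v}^*,\underline{v}^* )$ be an optimal extreme point of (D), and define $\pi'_t=\bigl\lfloor \pi^*_t/G+\tfrac12\bigr\rfloor$ for all $t\in T$. Then $(\delta^*,\pi')$ is an optimal solution of the futures opening auction problem. That is, $\delta^*$ and $\pi'$ are integral, they satisfy the clearing constraints, the quantity restrictions and both price conditions, and $\sum_{i\in I}\delta^*_i\ge\sum_{i\in I}\delta_i$ for every feasible solution $(\delta,\pi)$ of that problem.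
   Context: Instance. $T$ is a finite, totally ordered set of contracts, and $T'=T\cup\{\circ\}$ is obtained by adding a new maximum element $\circ$. $I$ is a finite set of orders. Each order $i\in I$ is associated with an arc $(r_i,s_i)\in T'\times T'$ with $r_i\ne s_i$ (demand $r_i$, offer $s_i$), an integer limit price, and a maximal quantity $\overline{\delta}_i\in\{1,2,3,\dots\}$. For $i\in I$ and $t\in T$: $Q_{i,t}=+1$ if $t=r_i$, $Q_{i,t}=-1$ if $t=s_i$, and $Q_{i,t}=0$ otherwise; $p_{i,t}\in\mathbb{Z}$ equals the limit price of order $i$ if $t=\min\{r_i,s_i\}$, and $p_{i,t}=0$ otherwise. Futures opening auction problem. Find $\delta\in\mathbb{Z}^I$ and $\pi\in\mathbb{Z}^T$ maximizing the executed volume $\sum_{i\in I}\delta_i$ subject to: (clearing) $\sum_{i\in I}Q_{i,t}\delta_i=0$ for all $t\in T$; (quantity) $0\le\delta_i\le\overline{\delta}_i$ for all $i\in I$; (price conditions) for all $i\in I$: if $\delta_i>0$ then $\sum_{t\in T}(p_{i,t}-\pi_t)Q_{i,t}\ge0$; and if $\delta_i<\overline{\delta}_i$ then $\sum_{t\in T}(p_{i,t}-\pi_t)Q_{i,t}\le0$. A pair $(\delta,\pi)$ satisfying all these constraints is a feasible solution; it is optimal if it maximizes $\sum_{i\in I}\delta_i$ among feasible solutions. *)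

(* Defs.v *)
From HB Require Import structures.
From mathcomp Require Import all_boot all_order all_algebra.
From mathcomp Require Import reals.

Set Implicit Arguments.
Unset Strict Implicit.
Unset Printing Implicit Defensive.

Import Order.TTheory GRing.Theory Num.Theory.
Local Open Scope ring_scope.

Section ExtendedContracts.
Context {d : Order.disp_t} {T : finOrderType d}.

(* T' is [option T]: [Some t] is the contract t, [None] is the new maximum. *)
Definition ext_le (x y : option T) : bool :=
  match x, y with
  | _, None => true
  | None, Some _ => false
  | Some a, Some b => (a <= b)%O
  end.

Definition ext_min (x y : option T) : option T := if ext_le x y then x else y.

End ExtendedContracts.

Record instance (d : Order.disp_t) (T : finOrderType d) (I : finType) :=
  Instance {
    demand : I -> option T;
    offer : I -> option T;
    demand_neq_offer : forall i, demand i <> offer i;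
    limit_price : I -> int;
    max_qty : I -> nat;
    max_qty_gt0 : forall i, (0 < max_qty i)%N
  }.

Section Auction.
Context {d : Order.disp_t} {T : finOrderType d} {I : finType}.
Variable a : instance T I.

Definition Q (i : I) (t : T) : int :=
  if Some t == demand a i then 1
  else if Some t == offer a i then -1
  else 0.

Definition p (i : I) (t : T) : int :=
  if Some t == ext_min (demand a i) (offer a i) then limit_price a i else 0.

Definition auction_feasible (delta : {ffun I -> int}) (pi : {ffun T -> int}) :
    Prop :=
  [/\ forall t, \sum_i Q i t * delta i = 0,
      forall i, 0 <= delta i <= (max_qty a i)%:Z,
      forall i, 0 < delta i -> 0 <= \sum_t (p i t - pi t) * Q i t
    & forall i, delta i < (max_qty a i)%:Z ->
        \sum_t (p i t - pi t) * Q i t <= 0].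

Definition auction_optimal (delta : {ffun I -> int}) (pi : {ffun T -> int}) :
    Prop :=
  auction_feasible delta pi /\
  forall (delta' : {ffun I -> int}) (pi' : {ffun T -> int}),
    auction_feasible delta' pi' -> \sum_i delta' i <= \sum_i delta i.

End Auction.

Definition extreme_point (R : realType) (V : lmodType R) (S : V -> Prop)
    (x : V) : Prop :=
  S x /\
  forall (y z : V) (l : R), S y -> S z -> 0 < l < 1 ->
    x = l *: y + (1 - l) *: z -> y = x /\ z = x.

Section LinearPrograms.
Context {d : Order.disp_t} {T : finOrderType d} {I : finType}.
Variables (R : realType) (a : instance T I) (G : R).

Definition clearing_mx : 'M[R]_(#|T|, #|I|) :=
  \matrix_(t, i) (Q a (enum_val i) (enum_val t))%:~R.

Definition weight (i : I) : R := 1 + G * \sum_t (p a i t)%:~R * (Q a i t)%:~R.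

Definition primal_feasible (delta : {ffun I -> R}) : Prop :=
  (forall t, \sum_i (Q a i t)%:~R * delta i = 0) /\
  (forall i, 0 <= delta i <= (max_qty a i)%:R).

Definition primal_value (delta : {ffun I -> R}) : R :=
  \sum_i weight i * delta i.

Definition primal_optimal_extreme (delta : {ffun I -> R}) : Prop :=
  extreme_point (V := {ffun I -> R^o}) primal_feasible delta /\
  forall delta', primal_feasible delta' ->
    primal_value delta' <= primal_value delta.

(* Dual points are triples (pi, upper v, lower v); [R^o] is [R] as a module over
   itself, which gives the triples their vector space structure. *)
Definition dual_point : lmodType R :=
  ({ffun T -> R^o} * {ffun I -> R^o} * {ffun I -> R^o})%type.

Definition dual_feasible (x : dual_point) : Prop :=
  let: (pi, vu, vl) := x in
  forall i,
    [/\ \sum_t (Q a i t)%:~R * pi t + vu i - vl i = weight i,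
        0 <= vu i & 0 <= vl i].

Definition dual_value (x : dual_point) : R :=
  let: (pi, vu, vl) := x in \sum_i (max_qty a i)%:R * vu i.

Definition dual_optimal_extreme (x : dual_point) : Prop :=
  extreme_point dual_feasible x /\
  forall x', dual_feasible x' -> dual_value x <= dual_value x'.

Definition rounded_prices (pi : {ffun T -> R}) : {ffun T -> int} :=
  [ffun t => Num.floor (pi t / G + 2^-1)].

End LinearPrograms.

(* Main.v *)
Require Import Defs.
From HB Require Import structures.
From mathcomp Require Import all_boot all_order all_algebra.
From mathcomp Require Import boolp reals ring lra zify.

Import Order.TTheory GRing.Theory Num.Theory.
Local Open Scope ring_scope.

(** Price all nodes of [T'], the reference contract at 0. At an extreme point of
    (D) the tight orders connect [T'], so growing a tree of tight orders from the
    reference contract gives [pi* = G n + k] with [n], [k] integral and all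
    differences of [k] at most [|T| < G / 2]. Hence [pi' = n], and the reduced
    cost of order [i] is [G e + (1 - dk)] with [e] its reduced surplus at [pi']
    and [|1 - dk| <= |T| + 1 < G], so [e] inherits its weak signs: complementary
    slackness for (P), (D) becomes the price conditions. Conversely the price
    conditions make every auction solution a clearing flow of maximal surplus,
    so that on these the objective of (P) ranks by volume. *)

(** * Farkas' lemma for finitely many functionals *)

Section Farkas.
Context {R : realFieldType} {J K : finType}.

Definition dot (f x : J -> R) : R := \sum_j f j * x j.

Lemma dotBl (f g x : J -> R) (c : R) :
  dot (fun j => f j - c * g j) x = dot f x - c * dot g x.
Proof. by rewrite mulr_sumr -sumrB; apply: eq_bigr => j _; ring. Qed.

Lemma dotBr (f g x : J -> R) (c : R) :
  dot f (fun j => x j - c * g j) = dot f x - c * dot f g.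
Proof. by rewrite mulr_sumr -sumrB; apply: eq_bigr => j _; ring. Qed.

Lemma dot_self_le0 (f : J -> R) : dot f f <= 0 -> forall j, f j = 0.
Proof.
move=> f_le0 j; apply/eqP; rewrite -sqrf_eq0 eq_le sqr_ge0 andbT.
apply: le_trans f_le0; rewrite /dot (bigD1 j) //= -expr2 lerDl.
by apply: sumr_ge0 => k _; rewrite -expr2 sqr_ge0.
Qed.

(* Induction on the constraints (Bartl): a direction violating the conclusion
   for the tail is used to project all functionals onto the kernel of the head. *)
Lemma farkas (s : seq K) (f : K -> J -> R) (b : J -> R) :
  uniq s ->
  (forall x : J -> R, (forall k, k \in s -> dot (f k) x <= 0) ->
    dot b x <= 0) ->
  exists2 l : K -> R, forall k, 0 <= l k &
    forall j, b j = \sum_(k <- s) l k * f k j.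
Proof.
elim: s f b => [|k0 s IHs] f b /=.
  move=> _ b_le0; exists (fun=> 0) => // j; rewrite big_nil.
  by apply: dot_self_le0; apply: b_le0.
case/andP=> k0s s_uniq b_le0.
have [noviol|] := pselect (forall x : J -> R,
    (forall k, k \in s -> dot (f k) x <= 0) -> dot b x <= 0).
  have [l l_ge0 bE] := IHs f b s_uniq noviol.
  exists (fun k => if k == k0 then 0 else l k) => [k|j]; first by case: ifP.
  rewrite big_cons eqxx mul0r add0r bE; apply: eq_big_seq => k ks.
  by case: eqP => // kk0; rewrite -kk0 ks in k0s.
move=> /existsNP[x0 /not_implyP[x0_le0 /negP]]; rewrite -ltNge => bx0_gt0.
set c := dot (f k0) x0.
have c_gt0 : 0 < c.
  rewrite ltNge; apply/negP => c_le0; move: bx0_gt0; rewrite ltNge => /negP; apply.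
  by apply: b_le0 => k; rewrite inE => /predU1P[->|/x0_le0].
have c_neq0 : c != 0 by rewrite gt_eqF.
(* Each functional is corrected by a multiple of [f k0] so as to vanish at [x0]; by [projE] this
   amounts to moving [x] along [x0] into the kernel of [f k0]. *)
have [||l l_ge0 bE] := IHs (fun k j => f k j - dot (f k) x0 / c * f k0 j)
    (fun j => b j - dot b x0 / c * f k0 j); first by [].
  move=> x x_le0; rewrite dotBl.
  have projE g : dot g x - dot g x0 / c * dot (f k0) x =
      dot g (fun j => x j - dot (f k0) x / c * x0 j).
    by rewrite dotBr; ring.
  rewrite projE; apply: b_le0 => k; rewrite inE => /predU1P[->|ks].
    by rewrite dotBr -/c divfK// subrr.
  by have := x_le0 _ ks; rewrite dotBl projE.
(* The head multiplier collects the [f k0] terms of the projections; it is nonnegative because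
   [dot b x0 > 0] while the tail is nonpositive at [x0]. *)
exists (fun k => if k == k0
    then (dot b x0 - \sum_(k <- s) l k * dot (f k) x0) / c else l k) => [k|j].
  case: ifP => // _; apply: divr_ge0; last exact: ltW.
  rewrite subr_ge0; apply: le_trans (ltW bx0_gt0).
  rewrite big_seq; apply: sumr_le0 => i iis.
  by apply: mulr_ge0_le0 => //; apply: x0_le0.
rewrite big_cons eqxx.
have -> : \sum_(k <- s) (if k == k0
    then (dot b x0 - \sum_(k <- s) l k * dot (f k) x0) / c else l k) * f k j =
    \sum_(k <- s) l k * f k j.
  apply: eq_big_seq => k ks.
  by case: eqP => // kk0; rewrite -kk0 ks in k0s.
have : b j - dot b x0 / c * f k0 j = _ := bE j.
under eq_bigr => k _ do rewrite mulrBr mulrA mulrA.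
rewrite sumrB -!mulr_suml => /eqP; rewrite subr_eq => /eqP ->.
by ring.
Qed.

End Farkas.

(** * Kernel vectors, small steps and extreme points *)

Lemma kernel_vector (F : fieldType) (I J : finType) (A : {set I}) (W : {set J})
    (M : I -> J -> F) : (#|W| < #|A|)%N ->
  exists y : I -> F, [/\ exists i, y i != 0, forall i, i \notin A -> y i = 0
    & forall j, j \in W -> \sum_i M i j * y i = 0].
Proof.
move=> ltWA.
pose B : 'M[F]_(#|A|, #|W|) := \matrix_(i, j) M (enum_val i) (enum_val j).
have : kermx B != 0.
  rewrite -mxrank_eq0 mxrank_ker subn_eq0 -ltnNge.
  exact: leq_ltn_trans (rank_leq_col _) ltWA.
case/rowV0Pn => v /sub_kermxP vB0 v_neq0.
have [i0 i0A] : exists i0, i0 \in A.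
  by apply/set0Pn; rewrite -card_gt0; apply: leq_ltn_trans ltWA.
pose y i := if i \in A then v 0 (enum_rank_in i0A i) else 0.
have yE k : y (enum_val k) = v 0 k by rewrite /y enum_valP enum_valK_in.
exists y; split => [|i /negPf iA|j jW]; last 2 first.
- by rewrite /y iA.
- transitivity ((v *m B) 0 (enum_rank_in jW j)); last by rewrite vB0 mxE.
  rewrite mxE (bigID (mem A)) /= [X in _ + X]big1 => [|i /negPf iA]; last first.
    by rewrite /y iA mulr0.
  rewrite addr0 big_enum_val; apply: eq_bigr => k _.
  by rewrite mxE yE enum_rankK_in // mulrC.
- have [k vk] : exists k, v 0 k != 0 by apply/rV0Pn.
  by exists (enum_val k); rewrite yE.
Qed.

(** The sum of all ratios [|y j| / g j] dominates each of them; the added 1 keeps it invertible. *)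
Lemma small_multiplier (R : realFieldType) (J : finType) (y g : J -> R) :
  (forall j, 0 < g j) -> exists2 e, 0 < e & forall j, e * `|y j| <= g j.
Proof.
move=> g_gt0; pose s := 1 + \sum_j `|y j| / g j.
have q_ge0 j : 0 <= `|y j| / g j by rewrite divr_ge0 // ltW.
have s_gt0 : 0 < s by rewrite ltr_pwDl // sumr_ge0.
exists s^-1 => [|j]; first by rewrite invr_gt0.
rewrite mulrC ler_pdivrMr // mulrC -ler_pdivrMr //.
rewrite /s (bigD1 j) //= addrCA lerDl addr_ge0 // sumr_ge0 //.
Qed.

Lemma box_direction (R : realFieldType) (J : finType) (x y u : J -> R) :
  (forall j, 0 <= x j <= u j) -> (forall j, x j = 0 -> 0 <= y j) ->
  (forall j, x j = u j -> y j <= 0) ->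
  exists2 e, 0 < e & forall j, 0 <= x j + e * y j <= u j.
Proof.
move=> x_box y_lo y_hi.
(* The step is limited by the distances to both bounds; a tight bound gets the dummy value 1, since
   there the sign of [y] suffices. *)
pose g j := Num.min (if x j == 0 then 1 else x j)
                    (if x j == u j then 1 else u j - x j).
have [|e e_gt0 eP] := @small_multiplier R J y g.
  move=> j; have /andP[x0 xu] := x_box j; rewrite lt_min.
  apply/andP; split; case: eqVneq => // ne; first by rewrite lt_neqAle eq_sym ne.
  by rewrite subr_gt0 lt_neqAle ne.
exists e => // j; have /andP[x0 xu] := x_box j.
have [] := (y_lo j, y_hi j); move: (eP j); rewrite le_min => /andP[].
have := ler_norm (y j); have := ler_norm (- y j); rewrite normrN.
move=> /(ler_wpM2l (ltW e_gt0)) + /(ler_wpM2l (ltW e_gt0)).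
rewrite mulrN => ? ?.
case: eqP => [x_eq0 _|_ ?]; case: eqP => [x_equ _|_ ?] ylo yhi.
- have := mulr_ge0 (ltW e_gt0) (ylo x_eq0).
  have := mulr_ge0_le0 (ltW e_gt0) (yhi x_equ); lra.
- have := mulr_ge0 (ltW e_gt0) (ylo x_eq0); lra.
- have := mulr_ge0_le0 (ltW e_gt0) (yhi x_equ); lra.
- lra.
Qed.

(** [x] is a convex combination of the two shifted points. Two step lengths are allowed, as the two
    directions may be blocked at different distances. *)
Lemma extreme_point_direction (R : realType) (V : lmodType R) (S : V -> Prop)
    (x v : V) (e1 e2 : R) : extreme_point S x -> 0 < e1 -> 0 < e2 ->
  S (x + e1 *: v) -> S (x - e2 *: v) -> v = 0.
Proof.
move=> [_ ext] e1_gt0 e2_gt0 S1 S2.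
have e_gt0 : 0 < e1 + e2 by exact: addr_gt0.
have [||+ _] := ext _ _ (e2 / (e1 + e2)) S1 S2.
- by rewrite divr_gt0 //= ltr_pdivrMr // mul1r ltrDr.
- have -> : 1 - e2 / (e1 + e2) = e1 / (e1 + e2).
    by field; rewrite gt_eqF.
  rewrite scalerDr scalerBr !scalerA addrACA -scalerDl.
  have -> : e2 / (e1 + e2) + e1 / (e1 + e2) = 1 by field; rewrite gt_eqF.
  have -> : e1 / (e1 + e2) * e2 = e2 / (e1 + e2) * e1 by field; rewrite gt_eqF.
  by rewrite scale1r subrr addr0.
move/(congr1 (fun z => z - x)); rewrite addrAC subrr add0r => /eqP.
by rewrite scaler_eq0 gt_eqF //= => /eqP.
Qed.

(** * Prices and flows on the network *)

Section Network.
Context {d : Order.disp_t} {T : finOrderType d} {I : finType}.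
Variable a : instance T I.

Lemma QE (V : pzRingType) i t : (Q a i t)%:~R =
  (Some t == demand a i)%:R - (Some t == offer a i)%:R :> V.
Proof.
rewrite /Q; case: eqP => [->|_].
  by case: eqP => [/demand_neq_offer//|_]; rewrite subr0.
case: eqP => _.
  by rewrite mulrN1z sub0r.
by rewrite subrr.
Qed.

Lemma sum_pred1 (V : pzRingType) (f : T -> V) (x : option T) :
  \sum_t (Some t == x)%:R * f t = oapp f 0 x.
Proof.
case: x => [t0|] /=; last by rewrite big1 // => t _; rewrite mul0r.
rewrite (bigD1 t0) //= eqxx mul1r big1 ?addr0 // => t /negPf tt0.
by rewrite (inj_eq Some_inj) tt0 mul0r.
Qed.

(* The new contract is the reference node, whose price is fixed to 0. *)
Lemma sum_Q_price (V : pzRingType) (f : T -> V) i :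
  \sum_t (Q a i t)%:~R * f t = oapp f 0 (demand a i) - oapp f 0 (offer a i).
Proof. by under eq_bigr do rewrite QE mulrBl; rewrite sumrB !sum_pred1. Qed.

(** The price-free part of the price conditions and the coefficient of [G] in the objective of (P):
    the link between the two problems. *)
Definition surplus i : int := \sum_t p a i t * Q a i t.

Lemma surplus_price (f : T -> int) i :
  \sum_t (p a i t - f t) * Q a i t =
  surplus i - (oapp f 0 (demand a i) - oapp f 0 (offer a i)).
Proof.
rewrite -sum_Q_price -sumrB; apply: eq_bigr => t _.
by rewrite intz mulrBl [f t * _]mulrC.
Qed.

Lemma weightE (R : realType) (G : R) i :
  weight a G i = 1 + G * (surplus i)%:~R.
Proof. by rewrite /weight rmorph_sum; under [in RHS]eq_bigr do rewrite rmorphM. Qed.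

(** After exchanging the sums each price multiplies a clearing equation: payments cancel on a
    balanced flow. *)
Lemma sum_Q_flow (V : comPzRingType) (f : T -> V) (g : I -> V) :
  (forall t, \sum_i (Q a i t)%:~R * g i = 0) ->
  \sum_i (\sum_t (Q a i t)%:~R * f t) * g i = 0.
Proof.
move=> g0; under eq_bigr do rewrite mulr_suml.
rewrite exchange_big big1 //= => t _.
under eq_bigr do rewrite mulrAC.
by rewrite -mulr_suml g0 mul0r.
Qed.

(** * Linear programming duality *)

Section Duality.
Variables (R : realType) (G : R).

(** At an optimum no feasible direction improves the objective. Farkas' lemma on the cone of these
    directions splits the weights into clearing multipliers, which become prices, and signed terms
    of tight bounds. *)
Lemma primal_multiplier (delta : {ffun I -> R}) :
  primal_feasible a delta ->
  (forall delta', primal_feasible a delta' ->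
    primal_value a G delta' <= primal_value a G delta) ->
  exists pi : {ffun T -> R}, forall i,
    (0 < delta i -> \sum_t (Q a i t)%:~R * pi t <= weight a G i) /\
    (delta i < (max_qty a i)%:R ->
      weight a G i <= \sum_t (Q a i t)%:~R * pi t).
Proof.
move=> [clear box] opt.
have u_gt0 i : 0 < (max_qty a i)%:R :> R by rewrite ltr0n max_qty_gt0.
(* The outward sign of the tight bound; capacities are positive, so at most one bound is tight. *)
pose sg i : R := if delta i == 0 then -1
  else if delta i == (max_qty a i)%:R then 1 else 0.
pose f (k : T + T + I) (i : I) : R := match k with
  | inl (inl t) => (Q a i t)%:~R
  | inl (inr t) => - (Q a i t)%:~R
  | inr i' => (i == i')%:R * sg i' end.
have sgE i' x : dot (f (inr i')) x = sg i' * x i'.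
  rewrite /dot (bigD1 i') //= eqxx mul1r big1 ?addr0 // => i /negPf ->.
  by rewrite !mul0r.
have [||l l_ge0 wE] := @farkas R I (T + T + I)%type (enum {: T + T + I}) f
    (weight a G); first exact: enum_uniq.
  move=> x fx.
  have {fx} fx k : dot (f k) x <= 0 by apply: fx; rewrite mem_enum.
  have Qx t : \sum_i (Q a i t)%:~R * x i = 0.
    apply/eqP; rewrite eq_le (fx (inl (inl t))) /=.
    have := fx (inl (inr t)); rewrite /dot /=.
    by under eq_bigr do rewrite mulNr; rewrite sumrN oppr_le0.
  have [||e e_gt0 eP] := @box_direction R I delta x (fun i => (max_qty a i)%:R)
      box.
  - by move=> i di0; have := fx (inr i); rewrite sgE /sg di0 eqxx mulN1r oppr_le0.
  - move=> i diu; have := fx (inr i); rewrite sgE /sg diu eqxx.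
    by rewrite gt_eqF // mul1r.
  have := opt [ffun i => delta i + e * x i]; rewrite /primal_value.
  under eq_bigr do rewrite ffunE mulrDr mulrCA.
  rewrite big_split /= -mulr_sumr gerDl pmulr_rle0 //; apply.
  split=> [t|i]; last by rewrite ffunE.
  under eq_bigr do rewrite ffunE mulrDr mulrCA.
  by rewrite big_split /= -mulr_sumr clear Qx mulr0 addr0.
exists [ffun t => l (inl (inl t)) - l (inl (inr t))] => i.
have {}wE : weight a G i = \sum_t (Q a i t)%:~R *
    [ffun t => l (inl (inl t)) - l (inl (inr t))] t + l (inr i) * sg i.
  rewrite wE big_enum !big_sumType /= -big_split /=; congr (_ + _).
    by apply: eq_bigr => t _; rewrite ffunE; ring.
  rewrite (bigD1 i) //= eqxx mul1r big1 ?addr0 // => j /negPf.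
  by rewrite eq_sym => ->; rewrite mul0r mulr0.
rewrite wE /sg; split=> [di_gt0|di_lt]; rewrite ?lerDl ?gerDl.
  by rewrite gt_eqF //; case: ifP => _; rewrite ?mulr1 ?mulr0.
rewrite (lt_eqF di_lt); case: ifP => _; rewrite ?mulr0 //.
by rewrite mulrN1 oppr_le0.
Qed.

(** The given prices need not be those of [primal_multiplier], but the latter extend to a dual point
    whose value is the primal optimum. So the given dual optimum has no gap, and the gap is a sum of
    nonnegative terms. *)
Lemma complementary_slackness (delta : {ffun I -> R}) (pi : {ffun T -> R})
    (vu vl : {ffun I -> R}) :
  primal_feasible a delta ->
  (forall delta', primal_feasible a delta' ->
    primal_value a G delta' <= primal_value a G delta) ->
  dual_feasible a G (pi, vu, vl) ->
  (forall x, dual_feasible a G x -> dual_value a (pi, vu, vl) <= dual_value a x) ->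
  forall i,
    (0 < delta i -> \sum_t (Q a i t)%:~R * pi t <= weight a G i) /\
    (delta i < (max_qty a i)%:R ->
      weight a G i <= \sum_t (Q a i t)%:~R * pi t).
Proof.
move=> feas popt dfeas dopt.
have [pi1 cs1] := primal_multiplier _ feas popt.
case: feas => clear box.
pose e1 i := weight a G i - \sum_t (Q a i t)%:~R * pi1 t.
have dfeas1 : dual_feasible a G
    (pi1, [ffun i => Num.max (e1 i) 0], [ffun i => Num.max (- e1 i) 0]).
  move=> i; rewrite !ffunE !le_max !lexx !orbT; split=> //.
  rewrite /e1; set w := weight a G i; set q := \sum_t _.
  by case: (leP (w - q) 0); case: (leP (- (w - q)) 0); lra.
have gapE : \sum_i (max_qty a i)%:R * [ffun i => Num.max (e1 i) 0] i =
    \sum_i e1 i * delta i.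
  apply: eq_bigr => i _; rewrite ffunE; have [cs_lo cs_hi] := cs1 i.
  have /andP[d0 du] := box i.
  case: (ltrgtP (e1 i) 0) => [e_lt|e_gt|->]; last by rewrite mulr0 mul0r.
    rewrite mulr0; have [/cs_lo|d_lt|<-] := ltrgtP 0 (delta i).
    - by rewrite -subr_ge0 -/(e1 i) leNgt e_lt.
    - by move: d0; rewrite leNgt d_lt.
    - by rewrite mulr0.
  have [/cs_hi|dE] := ltP (delta i) (max_qty a i)%:R.
    by rewrite -subr_le0 -/(e1 i) leNgt e_gt.
  by rewrite mulrC; congr (_ * _); apply: le_anti; rewrite dE du.
have := dopt _ dfeas1; rewrite /= gapE.
have valE (q : {ffun T -> R}) :
    \sum_i (weight a G i - \sum_t (Q a i t)%:~R * q t) * delta i =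
    primal_value a G delta.
  under eq_bigr do rewrite mulrBl.
  by rewrite sumrB sum_Q_flow // subr0.
rewrite /e1 valE -(valE pi) => le_gap.
have rE i : weight a G i - \sum_t (Q a i t)%:~R * pi t = vu i - vl i.
  by have [<- _ _] := dfeas i; ring.
have sum0 : \sum_i (((max_qty a i)%:R - delta i) * vu i + delta i * vl i) <= 0.
  move: le_gap; rewrite -subr_le0 -sumrB.
  by congr (_ <= _); apply: eq_bigr => i _; rewrite rE; ring.
have term0 i : ((max_qty a i)%:R - delta i) * vu i + delta i * vl i = 0.
  have ge0 j : 0 <= ((max_qty a j)%:R - delta j) * vu j + delta j * vl j.
    have /andP[d0 du] := box j; have [_ vu0 vl0] := dfeas j.
    by apply: addr_ge0; apply: mulr_ge0 => //; rewrite subr_ge0.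
  apply: le_anti; rewrite ge0 andbT; apply: le_trans sum0.
  by rewrite (bigD1 i) //= lerDl sumr_ge0.
move=> i; have /andP[d0 du] := box i; have [_ vu0 vl0] := dfeas i.
move: (term0 i) => /eqP; rewrite paddr_eq0 ?mulr_ge0 ?subr_ge0 // !mulf_eq0.
rewrite subr_eq0 => /andP[/orP vuE /orP vlE].
split=> [di_gt0|di_lt].
  rewrite -subr_ge0 rE; case: vlE => /eqP E; last by rewrite E subr0.
  by move: di_gt0; rewrite E ltxx.
rewrite -subr_le0 rE; case: vuE => /eqP E; last by rewrite E sub0r oppr_le0.
by move: di_lt; rewrite E ltxx.
Qed.

End Duality.
End Network.

(** * Tight orders at dual extreme points *)

Section ExtremePoints.
Context {d : Order.disp_t} {T : finOrderType d} {I : finType}.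
Variable a : instance T I.
Variables (R : realType) (G : R).

(* Otherwise the prices outside [S] could be shifted in both directions. *)
Lemma dual_tight_crossing (pi : {ffun T -> R}) (vu vl : {ffun I -> R})
    (S : {set option T}) :
  extreme_point (dual_feasible a G) (pi, vu, vl) ->
  None \in S -> S != setT ->
  exists i, [/\ vu i = 0, vl i = 0 & (demand a i \in S) != (offer a i \in S)].
Proof.
move=> ext NS ST; have [feas _] := ext.
apply: contrapT => /forallNP no_cross.
(* The reference price stays 0 since [None] lies in [S], and orders with both ends on one side keep
   their price difference. *)
pose y t : R := (Some t \notin S)%:R.
have yE x : oapp y 0 x = (x \notin S)%:R by case: x => //=; rewrite NS.
pose q i := \sum_t (Q a i t)%:~R * y t.
have q0 i : vu i = 0 -> vl i = 0 -> q i = 0.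
  move=> vu0 vl0; rewrite /q sum_Q_price !yE.
  case: (eqVneq (demand a i \in S) (offer a i \in S)) => [->|ne].
    by rewrite subrr.
  by case: (no_cross i).
(* The change [q i] is absorbed by [vu i] if positive, else by [vl i]; [g i] is the room there, with
   dummy 1 when both vanish and so [q i = 0]. *)
pose g i := if vu i == 0 then (if vl i == 0 then 1 else vl i) else vu i.
have [|e e_gt0 eP] := @small_multiplier R I q g.
  move=> i; have [_ vu0 vl0] := feas i; rewrite /g.
  by case: eqP => [_|/eqP ne]; [case: eqP => // /eqP ne|];
    rewrite lt_neqAle eq_sym ne.
pose v : @dual_point d T I R := ([ffun t => y t],
  [ffun i => if vu i == 0 then 0 else - q i],
  [ffun i => if vu i == 0 then q i else 0]).
have feas_shift s : `|s| = e ->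
    dual_feasible a G (((pi, vu, vl) : @dual_point d T I R) + s *: v).
  move=> s_e i; have [wE vu0 vl0] := feas i.
  have bound : `|s * q i| <= g i by rewrite normrM s_e.
  rewrite /= !ffunE.
  under eq_bigr do rewrite !ffunE.
  have -> : \sum_t (Q a i t)%:~R * (pi t + s *: (y t : R^o)) =
      \sum_t (Q a i t)%:~R * pi t + s * q i.
    by rewrite /q mulr_sumr -big_split; apply: eq_bigr => t _ /=; rewrite /GRing.scale /=; ring.
  rewrite -wE /GRing.scale /=; move: bound; rewrite ler_norml /g.
  case: (eqVneq (vu i) 0) => [vuE|_]; last first.
    by move=> /andP[? ?]; split; lra.
  case: (eqVneq (vl i) 0) => [vlE|_].
    by rewrite (q0 _ vuE vlE) vuE vlE => _; split; lra.
  by move=> /andP[? ?]; split; lra.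
have [] : v = 0.
  apply: (extreme_point_direction _ _ _ _ _ _ _ ext e_gt0 e_gt0).
    by apply: feas_shift; rewrite gtr0_norm.
  by rewrite -scaleNr; apply: feas_shift; rewrite normrN gtr0_norm.
move=> /ffunP y0 _ _; case/negP: ST; rewrite -subTset.
apply/subsetP => -[t|] _ //; move: (y0 t); rewrite !ffunE /y.
by case: (_ \in S) => //= /eqP; rewrite oner_eq0.
Qed.

(** With both slacks zero, the dual constraint fixes the price difference at [1 + G * surplus].
    Solved for the end outside [S], it gives [s = 1] for a demand and [s = -1] for an offer. *)
Lemma dual_crossing_step (pi : {ffun T -> R}) (vu vl : {ffun I -> R})
    (S : {set option T}) :
  extreme_point (dual_feasible a G) (pi, vu, vl) ->
  None \in S -> S != setT ->
  exists x z (c s : int), [/\ x \in S, z \notin S, `|s| <= 1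
    & oapp pi 0 z = oapp pi 0 x + G * c%:~R + s%:~R].
Proof.
move=> ext NS ST; have [feas _] := ext.
have [i [vu0 vl0 cross]] := dual_tight_crossing _ _ _ _ ext NS ST.
have [+ _ _] := feas i; rewrite vu0 vl0 addr0 subr0 sum_Q_price weightE => wE.
case dS: (demand a i \in S) cross; case oS: (offer a i \in S) => // _.
  exists (demand a i), (offer a i), (- surplus a i), (-1); split=> //.
    by rewrite oS.
  by rewrite !rmorphN; lra.
exists (offer a i), (demand a i), (surplus a i), 1; split=> //.
  by rewrite dS.
by lra.
Qed.

(* The set [S] is grown from the reference node by tight arcs; each new node
   changes [k] by at most one, which keeps the spread of [k] below the size. *)
Lemma dual_extreme_potential (pi : {ffun T -> R}) (vu vl : {ffun I -> R})
    (m : nat) :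
  extreme_point (dual_feasible a G) (pi, vu, vl) -> (m <= #|T|)%N ->
  exists (S : {set option T}) (n k : option T -> int),
    [/\ #|S| = m.+1, None \in S, n None = 0 /\ k None = 0,
        forall x, x \in S -> oapp pi 0 x = G * (n x)%:~R + (k x)%:~R
      & forall x y, x \in S -> y \in S -> `|k x - k y| <= m%:Z].
Proof.
move=> ext; elim: m => [_|m IHm m_lt].
  exists [set None], (fun=> 0), (fun=> 0); split; rewrite ?cards1 ?set11 //.
    by move=> x /set1P ->; rewrite mulr0 addr0.
have [S [n [k [Sm NS [n0 k0] piE k_le]]]] := IHm (ltnW m_lt).
have ST : S != setT.
  apply/eqP => SE; move: Sm; rewrite SE cardsT card_option => -[Tm].
  by rewrite Tm ltnn in m_lt.
have [x [z [c [s [xS zS s_le piz]]]]] := dual_crossing_step _ _ _ _ ext NS ST.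
have zN : None != z by apply: contraNneq zS => <-.
have Sz y : y \in S -> (y == z) = false.
  by move=> yS; apply: contraNF zS => /eqP <-.
exists (z |: S), (fun y => if y == z then n x + c else n y),
  (fun y => if y == z then k x + s else k y); split.
- by rewrite cardsU1 zS Sm.
- by rewrite !inE NS orbT.
- by rewrite (negPf zN).
- move=> y; rewrite !inE => /predU1P[->|yS]; last by rewrite Sz // piE.
  by rewrite eqxx piz piE // !rmorphD /=; ring.
have stepE y : y \in S -> `|k x + s - k y| <= m.+1%:Z.
  by move=> yS; have := k_le _ _ xS yS; rewrite !ler_norml; lia.
move=> y1 y2; rewrite !inE => /predU1P[->|yS1] /predU1P[->|yS2]; rewrite ?eqxx.
- by rewrite subrr normr0.
- by rewrite Sz // stepE.
- by rewrite Sz // distrC stepE.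
- by rewrite !Sz //; have := k_le _ _ yS1 yS2; lia.
Qed.

(** * Integrality of primal extreme points *)

Definition incidence (i : I) (x : option T) : R :=
  (x == demand a i)%:R - (x == offer a i)%:R.

(** Each order contributes [+1] and [-1] over the nodes of [T'], so the balance at one node follows
    from all others. *)
Lemma incidence_balance (y : I -> R) (x0 : option T) :
  (forall x, x != x0 -> \sum_i incidence i x * y i = 0) ->
  \sum_i incidence i x0 * y i = 0.
Proof.
move=> bal.
have indicator (c : option T) : \sum_x (x == c)%:R = 1 :> R.
  by rewrite (bigD1 c) //= eqxx big1 ?addr0 // => x /negPf ->.
transitivity (\sum_x \sum_i incidence i x * y i).
  by rewrite [RHS](bigD1 x0) //= [X in _ + X]big1 ?addr0.
rewrite exchange_big big1 //= => i _.
by rewrite -mulr_suml sumrB !indicator subrr mul0r.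
Qed.

Lemma primal_balance (delta : {ffun I -> R}) x :
  primal_feasible a delta -> \sum_i incidence i x * delta i = 0.
Proof.
move=> [clear _].
have balS t : \sum_i incidence i (Some t) * delta i = 0.
  by rewrite -[RHS](clear t); apply: eq_bigr => i _; rewrite QE.
by case: x => [t|] //; apply: incidence_balance => -[t|].
Qed.

(* Were the fractional orders nonempty, every contract they touch would be
   touched twice, so there would be at least as many of them as of contracts;
   since one clearing equation is redundant they support a circulation. *)
Lemma primal_extreme_int (delta : {ffun I -> R}) :
  extreme_point (V := {ffun I -> R^o}) (primal_feasible a) delta ->
  forall i, delta i \is a Num.int.
Proof.
move=> ext i0; apply/negPn/negP => i0_frac; have [feas _] := ext.
pose F := [set i | delta i \isn't a Num.int].
pose touch i x := (x == demand a i) || (x == offer a i).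
pose V := [set x | [exists i in F, touch i x]].
have touchV i x : i \in F -> touch i x -> x \in V.
  by move=> iF ix; rewrite inE; apply/existsP; exists i; rewrite iF.
have inc0 i x : ~~ touch i x -> incidence i x = 0.
  by rewrite negb_or /incidence => /andP[/negPf -> /negPf ->]; rewrite subrr.
have incT i x z : touch i x -> incidence i x * z \is a Num.int ->
    z \is a Num.int.
  rewrite /touch /incidence; case: eqP => [->|_] /=.
    by case: eqP => [/demand_neq_offer//|_ _]; rewrite subr0 mul1r.
  by move=> ->; rewrite sub0r mulN1r rpredN.
(* If a single fractional order met [x], balance would express its quantity by integral ones. *)
have deg x : x \in V -> (2 <= #|[set i in F | touch i x]|)%N.
  rewrite inE => /existsP[i1 /andP[i1F i1x]]; rewrite leqNgt; apply/negP => deg1.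
  have only i : i \in F -> touch i x -> i = i1.
    move=> iF ix; apply/eqP; apply: contraTT deg1 => ne.
    rewrite -leqNgt; apply/card_gt1P; exists i, i1; split=> //.
      by rewrite inE iF.
    by rewrite inE i1F.
  suff : delta i1 \is a Num.int by move: i1F; rewrite inE => /negPf ->.
  apply: (incT _ _ _ i1x).
  have := primal_balance _ x feas; rewrite (bigD1 i1) //= => /eqP.
  rewrite addr_eq0 => /eqP ->; rewrite rpredN; apply: rpred_sum => i ne.
  case: (boolP (i \in F)) => [iF|].
    case: (boolP (touch i x)) => [ix|/inc0 ->]; last by rewrite mul0r rpred0.
    by rewrite (only _ iF ix) eqxx in ne.
  by rewrite inE negbK => di; rewrite rpredM // /incidence rpredB ?natr_int.
(* Touching pairs are counted twice: at least two per node of [V], at most two per order. *)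
have VF : (#|V| <= #|F|)%N.
  rewrite -(leq_pmul2r (isT : 0 < 2)%N) -!sum_nat_const.
  apply: (@leq_trans (\sum_(x in V) \sum_(i in F) touch i x)).
    apply: leq_sum => x xV; apply: leq_trans (deg _ xV) _.
    rewrite -sum1_card big_mkcond [leqRHS]big_mkcond /=; apply: leq_sum => i _.
    by rewrite inE; case: (_ \in F); case: (touch i x).
  rewrite exchange_big /=; apply: leq_sum => i _.
  apply: (@leq_trans (\sum_x ((x == demand a i) + (x == offer a i)))).
    rewrite big_mkcond; apply: leq_sum => x _; rewrite /touch.
    by case: (_ \in V); case: (x == _); case: (x == _).
  have sum_eq c : (\sum_(x : option T) (x == c) = 1)%N.
    by rewrite (bigD1 c) //= eqxx big1 // => x /negPf ->.
  by rewrite big_split /= !sum_eq.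
have i0F : i0 \in F by rewrite inE.
(* Dropping node [x0] leaves fewer equations than the unknowns in [F]. *)
pose x0 := demand a i0.
have x0V : x0 \in V by apply: (touchV i0); rewrite // /touch eqxx.
have [|y [[i1 yi1] yF yW]] := @kernel_vector R _ _ F (V :\ x0) incidence.
  by apply: leq_trans VF; rewrite [leqRHS](cardsD1 x0) x0V.
have yV x : x != x0 -> \sum_i incidence i x * y i = 0.
  move=> xx0; case: (boolP (x \in V)) => xV.
    by apply: yW; rewrite in_setD1 xx0.
  apply: big1 => i _; case: (boolP (i \in F)) => [iF|/yF ->]; last exact: mulr0.
  by rewrite inc0 ?mul0r //; apply: contra xV; apply: touchV.
have Qy t : \sum_i (Q a i t)%:~R * y i = 0.
  under eq_bigr do rewrite QE.
  have [x0E|ne] := eqVneq (Some t) x0; last exact: yV.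
  by rewrite x0E; apply: incidence_balance.
case: feas => clear box.
(* The bounds are integers, so [y] vanishes wherever one is tight, and both signs of [y] are
   feasible directions. *)
have y_int z i : z \is a Num.int -> delta i = z -> y i = 0.
  by move=> z_int dz; apply: yF; rewrite inE dz z_int.
have shift s : exists2 e, 0 < e &
    primal_feasible a [ffun i => delta i + e * (s * y i)].
  have [||e e_gt0 eP] := @box_direction R I delta (fun i => s * y i)
      (fun i => (max_qty a i)%:R) box.
  - by move=> i /y_int ->; rewrite ?mulr0 ?rpred0.
  - by move=> i /y_int ->; rewrite ?mulr0 ?natr_int.
  exists e => //; split=> [t|i]; last by rewrite ffunE.
  transitivity (\sum_i (Q a i t)%:~R * delta i +
    e * s * \sum_i (Q a i t)%:~R * y i); last by rewrite clear Qy mulr0 addr0.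
  by rewrite mulr_sumr -big_split; apply: eq_bigr => i _; rewrite ffunE /=; ring.
have [e1 e1_gt0 feas1] := shift 1; have [e2 e2_gt0 feas2] := shift (-1).
pose v : {ffun I -> R^o} := [ffun i => y i].
have : v = 0.
  apply: (extreme_point_direction _ _ _ _ _ _ _ ext e1_gt0 e2_gt0).
    congr (primal_feasible a _): feas1; apply/ffunP => i.
    by rewrite !ffunE mul1r.
  congr (primal_feasible a _): feas2; apply/ffunP => i.
  by rewrite !ffunE mulN1r mulrN.
by move=> /ffunP/(_ i1); rewrite !ffunE => /eqP; rewrite (negPf yi1).
Qed.

End ExtremePoints.

(** * Auction optimality and rounding *)

(** Prices cancel on balanced flows, and the price conditions make [delta] maximize the reduced
    surplus order by order: full where it is positive, zero where it is negative. *)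
Lemma auction_surplus_max (d : Order.disp_t) (T : finOrderType d) (I : finType)
    (a : instance T I) (delta delta' : {ffun I -> int}) (pi : {ffun T -> int}) :
  auction_feasible a delta pi ->
  (forall t, \sum_i Q a i t * delta' i = 0) ->
  (forall i, 0 <= delta' i <= (max_qty a i)%:Z) ->
  \sum_i surplus a i * delta' i <= \sum_i surplus a i * delta i.
Proof.
move=> [clear box pc_lo pc_hi] clear' box'.
pose r i := \sum_t (p a i t - pi t) * Q a i t.
have reducedE (y : I -> int) : (forall t, \sum_i Q a i t * y i = 0) ->
    \sum_i surplus a i * y i = \sum_i r i * y i.
  move=> y0; rewrite /r; under [RHS]eq_bigr do rewrite surplus_price -sum_Q_price mulrBl.
  rewrite sumrB sum_Q_flow ?subr0 // => t.
  by rewrite -[RHS](y0 t); apply: eq_bigr => i _; rewrite intz.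
rewrite !reducedE //; apply: ler_sum => i _.
have /andP[lo' hi'] := box' i; have /andP[lo hi] := box i.
have := pc_lo i; have := pc_hi i; rewrite -/(r i).
have [r_gt0 hi_r _|r_lt0 _ lo_r|<-] := ltgtP 0 (r i); last by rewrite !mul0r.
  have -> : delta i = (max_qty a i)%:Z.
    by apply: le_anti; rewrite hi leNgt; apply/negP => /hi_r.
  by rewrite ler_pM2l.
have -> : delta i = 0.
  by apply: le_anti; rewrite lo andbT leNgt; apply/negP => /lo_r.
by rewrite mulr0 mulr_le0_ge0 // ltW.
Qed.

Lemma primal_valueE (R : realType) (d : Order.disp_t) (T : finOrderType d)
    (I : finType) (a : instance T I) (G : R) (delta : {ffun I -> int}) :
  primal_value a G [ffun i => (delta i)%:~R] =
  (\sum_i delta i)%:~R + G * (\sum_i surplus a i * delta i)%:~R.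
Proof.
rewrite /primal_value !rmorph_sum mulr_sumr -big_split; apply: eq_bigr => i _ /=.
by rewrite ffunE weightE rmorphM /=; ring.
Qed.

(** [|1 - c| <= N + 1 <= 2 * N < G], whereas an integer [e] of the wrong sign contributes at least
    [G] in absolute value. *)
Lemma sign_of_scaled (R : realType) (G : R) (N : nat) (e c : int) :
  (1 <= N)%N -> 2 * N%:R < G -> `|c| <= N%:Z ->
  (0 <= G * e%:~R + (1 - c%:~R) -> 0 <= e) /\
  (G * e%:~R + (1 - c%:~R) <= 0 -> e <= 0).
Proof.
move=> N_gt0 G_gt c_le.
have N_ge1 : 1 <= N%:R :> R by rewrite ler1n.
have : `|c%:~R| <= N%:R :> R by rewrite -intr_norm -[N%:R]/(N%:Z%:~R) ler_int.
rewrite ler_norml => /andP[c_lo c_hi].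
have G_gt0 : 0 < G by lra.
split=> H; rewrite leNgt; apply/negP => e_sign.
  have : e%:~R <= -1 :> R by rewrite -[-1]/((-1)%:~R) ler_int; lia.
  by move=> /(ler_wpM2l (ltW G_gt0)); lra.
have : 1 <= e%:~R :> R by rewrite -[1]/(1%:~R) ler_int; lia.
by move=> /(ler_wpM2l (ltW G_gt0)); lra.
Qed.

(** As [|k| / G < 1/2], the argument of the floor lies strictly between [n] and [n + 1]. *)
Lemma floor_scaled (R : realType) (G : R) (N : nat) (n k : int) :
  2 * N%:R < G -> `|k| <= N%:Z ->
  Num.floor ((G * n%:~R + k%:~R) / G + 2^-1) = n.
Proof.
move=> G_gt k_le.
have : `|k%:~R| <= N%:R :> R by rewrite -intr_norm -[N%:R]/(N%:Z%:~R) ler_int.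
rewrite ler_norml => /andP[k_lo k_hi].
have N_ge0 : 0 <= N%:R :> R by rewrite ler0n.
have G_gt0 : 0 < G by lra.
have k_lt : - 2^-1 < k%:~R / G < 2^-1.
  by rewrite ltr_pdivlMr // ltr_pdivrMr //; lra.
apply: floor_def; rewrite rmorphD /= mulrDl mulrAC mulfV ?gt_eqF // mul1r.
by case/andP: k_lt; lra.
Qed.

Theorem mainTheorem1 (R : realType) (d : Order.disp_t) (T : finOrderType d)
    (I : finType) (a : instance T I)
    (T_gt0 : (1 <= #|T|)%N)
    (Q_rank : \rank (clearing_mx R a) = #|T|)
    (G : R) (G_gt : 2 * #|T|%:R < G)
    (deltaS : {ffun I -> R})
    (deltaS_opt : primal_optimal_extreme a G deltaS)
    (piS : {ffun T -> R}) (vuS vlS : {ffun I -> R})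
    (dualS_opt : dual_optimal_extreme a G (piS, vuS, vlS)) :
  exists delta : {ffun I -> int},
    (forall i, deltaS i = (delta i)%:~R) /\
    auction_optimal a delta (rounded_prices G piS).
Proof.
case: deltaS_opt => extP optP; case: dualS_opt => extD optD.
have [[clear box] _] := extP; have [feasD _] := extD.
have G_gt0 : 0 < G by apply: le_lt_trans G_gt; rewrite mulr_ge0.
have cs := complementary_slackness _ _ _ _ _ _ _ (conj clear box) optP feasD optD.
(* With [m = #|T|] the set [S] has [#|T| + 1] elements, hence is all of [T']. *)
have [S [n [k [Scard _ [n0 k0] piE k_le]]]] :=
  dual_extreme_potential _ _ _ _ _ _ _ extD (leqnn #|T|).
have Sx x : x \in S.
  suff -> : S = setT by rewrite inE.
  by apply/eqP; rewrite eqEcard subsetT cardsT card_option Scard /=.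
have roundE x : oapp (rounded_prices G piS) 0 x = n x.
  case: x => [t|] //=; rewrite ffunE -[piS t]/(oapp piS 0 (Some t)) piE //.
  apply: (floor_scaled _ _ _ _ _ G_gt).
  by have := k_le _ _ (Sx (Some t)) (Sx None); rewrite k0 subr0.
pose e i := surplus a i - (n (demand a i) - n (offer a i)).
pose c i := k (demand a i) - k (offer a i).
have slackE i : weight a G i - \sum_t (Q a i t)%:~R * piS t =
    G * (e i)%:~R + (1 - (c i)%:~R).
  by rewrite sum_Q_price weightE !piE // /e /c !rmorphB /=; ring.
have signE i := @sign_of_scaled R G #|T| (e i) (c i) T_gt0 G_gt
  (k_le _ _ (Sx _) (Sx _)).
pose delta : {ffun I -> int} := [ffun i => Num.floor (deltaS i)].
have deltaE i : deltaS i = (delta i)%:~R.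
  by rewrite ffunE floorK //; apply: primal_extreme_int extP i.
have deltaE' : deltaS = [ffun i => (delta i)%:~R].
  by apply/ffunP => i; rewrite [RHS]ffunE.
have clearZ t : \sum_i Q a i t * delta i = 0.
  apply: (@intr_inj R); rewrite rmorph_sum /= -[RHS](clear t).
  by apply: eq_bigr => i _; rewrite rmorphM deltaE.
have boxZ i : 0 <= delta i <= (max_qty a i)%:Z.
  have := box i; rewrite deltaE.
  by rewrite ler0z -[(max_qty a i)%:R]/((max_qty a i)%:Z%:~R) ler_int.
exists delta; split=> //; split.
  split=> // i; rewrite surplus_price !roundE -/(e i) => di.
    apply: (signE i).1; rewrite -slackE subr_ge0; apply: (cs i).1.
    by rewrite deltaE ltr0z.
  apply: (signE i).2; rewrite -slackE subr_le0; apply: (cs i).2.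
  by rewrite deltaE -[(max_qty a i)%:R]/((max_qty a i)%:Z%:~R) ltr_int.
move=> delta1 pi1 feas1; have [clear1 box1 _ _] := feas1.
(* Here the rival [delta1] is the maximizer: [delta] has at most its surplus, yet at least its value
   in (P), hence at least its volume. *)
have surplus_le := auction_surplus_max _ _ _ _ _ _ _ feas1 clearZ boxZ.
have feas1R : primal_feasible a ([ffun i => (delta1 i)%:~R] : {ffun I -> R}).
  split=> [t|i].
    rewrite -[RHS](rmorph0 intr) -(clear1 t) rmorph_sum.
    by apply: eq_bigr => i _; rewrite ffunE rmorphM.
  by rewrite ffunE ler0z -[(max_qty a i)%:R]/((max_qty a i)%:Z%:~R) ler_int.
have := optP _ feas1R; rewrite deltaE' !primal_valueE => opt1.
rewrite -(ler_int R); move: surplus_le; rewrite -(ler_int R).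
by move=> /(ler_wpM2l (ltW G_gt0)); lra.
Qed.
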